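(* Let $q \in \{2,3\}$, let $\sigma_2 = 2$ and $\sigma_3 = C_0$ (the constant described in the context), and let $t \geq 0$. Then for every $n$, \[\mathrm{ex}_{\mathrm{aff}}(n, \mathbb F_q^t) < q^{\,n - (n-t)/(\sigma_q^t - t)}.\] Moreover, if $A \subseteq \mathbb F_q^n$ with $|A| = D q^{(1 - 1/(\sigma_q^t - t))n}$ for some $D > 0$, then $A$ contains more than \[\left(1 - \frac{q^t}{D^{\sigma_q^t - t}}\right)\frac{\alpha^{\sigma_q^t} N^{t+1}}{|\mathrm{Aut}_{\mathrm{aff}}(\mathbb F_q^t)|}\] affine $t$-dimensional subspaces, where $N = q^n$ and $|A| = \alpha N$.
   Context: $\mathrm{ex}_{\mathrm{aff}}(n,\mathbb F_q^t)$ is the maximum size of a subset of $\mathbb F_q^n$ containing no affine subspace of dimension $t$. $\mathrm{Aut}_{\mathrm{aff}}(\mathbb F_q^t)$ is the group of bijective affine maps $\mathbb F_q^t \to \mathbb F_q^t$. The constant $C_0 \approx 13.901$ is the absolute constant $C_0 = 1 + 1/(1-\log_3 \gamma)$ with $\gamma = \min_{0<x<1}(1+x+x^2)/x^{2/3} \approx 2.7552$ (the constant of Fox–Pham's theorem); it has the known property that every $A \subseteq \mathbb F_3^n$ with $|A| = \alpha 3^n$ contains at least $\alpha^{C_0} 3^{2n}$ triples of the form $(x, x+d, x+2d)$ with $x,d \in \mathbb F_3^n$. *)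

(* Defs.v *)
From HB Require Import structures.
From mathcomp Require Import all_boot all_order all_algebra.
From mathcomp Require Import classical_sets reals exp.
Set Implicit Arguments. Unset Strict Implicit. Unset Printing Implicit Defensive.
Import Order.TTheory GRing.Theory Num.Theory.

Local Open Scope ring_scope.

Definition is_aff_subspace (q n t : nat) (S : {set 'rV['F_q]_n}) : bool :=
  [exists x0 : 'rV['F_q]_n, exists B : 'M['F_q]_(t, n),
     (\rank B == t) && (S == [set x0 + u *m B | u : 'rV['F_q]_t])].

Definition aff_free (q n t : nat) (A : {set 'rV['F_q]_n}) : bool :=
  [forall S : {set 'rV['F_q]_n}, is_aff_subspace t S ==> ~~ (S \subset A)].

Definition ex_aff (q n t : nat) : nat :=
  (\max_(A : {set 'rV['F_q]_n} | aff_free t A) #|A|)%N.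

Definition num_aff_in (q n t : nat) (A : {set 'rV['F_q]_n}) : nat :=
  #|[set S : {set 'rV['F_q]_n} | is_aff_subspace t S && (S \subset A)]|.

Definition Aut_aff (q t : nat) : {set {ffun 'rV['F_q]_t -> 'rV['F_q]_t}} :=
  [set f : {ffun 'rV['F_q]_t -> 'rV['F_q]_t} |
     [exists M : 'M['F_q]_t, exists b : 'rV['F_q]_t,
        f == [ffun x => x *m M + b]] && injectiveb f].

(* gamma = min_{0<x<1} (1+x+x^2)/x^{2/3} (written as an infimum; it is attained) *)
Definition gammaFP (R : realType) : R :=
  inf [set (1 + x + x ^+ 2) / powR x (2 / 3) | x in [set x : R | 0 < x < 1]].

Definition C0 (R : realType) : R :=
  1 + 1 / (1 - ln (gammaFP R) / ln 3).

Definition sigma (R : realType) (q : nat) : R :=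
  if q == 2%N then 2 else C0 R.

(* Main.v *)
Require Import Defs.
From HB Require Import structures.
From mathcomp Require Import all_boot all_order all_algebra.
From mathcomp Require Import classical_sets reals exp.
From mathcomp Require Import ring lra zify.
Import Order.TTheory GRing.Theory Num.Theory.
Set Implicit Arguments. Unset Strict Implicit. Unset Printing Implicit Defensive.
Local Open Scope ring_scope.

(** Affine maps [F_q^t -> A], degenerate ones included, number at least
    [alpha^(sigma^t) N^(t+1)]: intersecting the translates of [A] along a random direction
    [v] leaves a set of average density at least [alpha^sigma], so convexity and induction
    on [t] apply. Fewer than [q^t |A|^t] tuples of points of [A] are affinely dependent,
    and a subspace is parametrised in at most [|Aut|] ways.

    The case [t = 1] is an identity for [q = 2]; for [q = 3] it is the Fox-Pham
    bound on solutions of [x + y + z = 0] in [A]. Deleting points of degree above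
    [C0 * average] does not increase [T / |A|^C0], so degrees may be assumed bounded.
    Pulling [A] back along random affine maps from [F_3^d], with [3^d] of order
    [|A| N / T], leaves about [3^(2d) T / N^2] isolated solutions, which form a tricoloured
    sum-free set; the slice rank method bounds these by [3 gammaFP^d]. The constant lost
    is removed by tensor powers. *)

(** * Slice rank of the diagonal tensor *)

(** The left kernel of [Y] has dimension [r >= m - k], so some [r] columns of a basis of it form an
    invertible block; inverting that block yields a kernel vector equal to 1 on those
    coordinates. *)
Lemma annihilator_large_support (F : fieldType) (m k : nat) (Y : 'M[F]_(m, k)) :
  exists r (f : 'I_r -> 'I_m) (h : 'rV[F]_m),
    [/\ (m <= r + k)%N, injective f, h *m Y = 0 & forall i, h 0 (f i) = 1].
Proof.
set K := row_base (kermx Y).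
have fullK : row_full K^T by rewrite /row_full mxrank_tr; apply: row_base_free.
pose f := fullrankfun fullK.
have Ku : colsub f K \in unitmx.
  rewrite -unitmx_tr.
  have -> : (colsub f K)^T = rowsub f K^T by apply/matrixP=> i j; rewrite !mxE.
  exact: fullrowsub_unit.
pose h : 'rV_m := const_mx 1 *m invmx (colsub f K) *m K.
exists _, f, h; split.
- rewrite mxrank_ker; have := rank_leq_col Y; lia.
- by move=> i j /fullrankfun_inj.
- have KY : K *m Y = 0 by apply/eqP; rewrite -sub_kermx /K eq_row_base.
  have KvY v : v *m K *m Y = 0 :> 'rV_k by rewrite -(mulmxA v) KY mulmx0.
  exact: KvY.
- move=> i; have -> : h 0 (f i) = (colsub f h) 0 i by rewrite [RHS]mxE.
  have -> : colsub f h = const_mx 1 :> 'rV_ _; last by rewrite mxE.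
  by rewrite /h -mulmx_colsub -(mulmxA _ _ (colsub f K)) mulVmx // mulmx1.
Qed.

(** Contracting the first index with an [h] that kills every [P] slice leaves [diag_mx h], which the
    [Q] and [S] slices show to have rank at most [k + k]. It contains an identity block of size
    [r >= m - k]. *)
Lemma diag_tensor_slices (F : fieldType) (m k : nat)
    (P Q S : 'I_k -> 'I_m -> F) (G1 G2 G3 : 'I_k -> 'I_m -> 'I_m -> F) :
  (forall i j l, \sum_(a < k) P a i * G1 a j l + \sum_(a < k) Q a j * G2 a i l
     + \sum_(a < k) S a l * G3 a i j = ((i == j) && (j == l))%:R) ->
  (m <= 3 * k)%N.
Proof.
move=> E.
have [r [f [h [mr f_inj hY hf]]]] := annihilator_large_support (\matrix_(i, a) P a i).
pose W := (\matrix_(j, a) Q a j) *m (\matrix_(a, l) \sum_i h 0 i * G2 a i l)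
  + (\matrix_(j, a) \sum_i h 0 i * G3 a i j) *m (\matrix_(a, l) S a l).
have WE : W = diag_mx h.
  apply/matrixP=> j l; rewrite !mxE.
  transitivity (\sum_i h 0 i * ((i == j) && (j == l))%:R).
    under [RHS]eq_bigr => i _ do rewrite -E !mulrDr.
    rewrite !big_split /= [X in _ = X + _ + _](_ : _ = 0) ?add0r.
      congr (_ + _).
        under eq_bigr => a _ do rewrite !mxE mulr_sumr.
        rewrite exchange_big /=; apply: eq_bigr => i _; rewrite mulr_sumr.
        by apply: eq_bigr => a _; rewrite mulrCA.
      under eq_bigr => a _ do rewrite !mxE mulr_suml.
      rewrite exchange_big /=; apply: eq_bigr => i _; rewrite mulr_sumr.
      by apply: eq_bigr => a _; ring.
    under eq_bigr => i _ do rewrite mulr_sumr.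
    rewrite exchange_big /= big1 // => a _.
    under eq_bigr => i _ do rewrite mulrA.
    rewrite -mulr_suml; have /rowP/(_ a) := hY; rewrite !mxE => hYa.
    rewrite [X in X * _](_ : _ = 0) ?mul0r // -[RHS]hYa.
    by apply: eq_bigr => i _; rewrite mxE.
  rewrite (bigD1 j) //= eqxx /= big1 ?addr0 ?mulr_natr // => i /negPf ->.
  by rewrite mulr0.
have : (\rank (mxsub f f W) <= k + k)%N.
  have -> : mxsub f f W = rowsub f 1%:M *m W *m colsub f 1%:M.
    by rewrite mul_rowsub_mx mul1mx mulmx_colsub mulmx1; apply/matrixP=> i j; rewrite !mxE.
  apply: leq_trans (mxrankM_maxl _ _) _; apply: leq_trans (mxrankM_maxr _ _) _.
  apply: leq_trans (mxrank_add _ _) _; apply: leq_add.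
    exact: leq_trans (mxrankM_maxl _ _) (rank_leq_col _).
  exact: leq_trans (mxrankM_maxr _ _) (rank_leq_row _).
have -> : mxsub f f W = 1%:M.
  by rewrite WE; apply/matrixP=> i j; rewrite !mxE hf (inj_eq f_inj).
rewrite mxrank1; lia.
Qed.

(** * Tricolored sum-free sets over [F_3] *)

(** Exponent vectors of the monomials of total degree at most [2d/3] with every exponent at most
    2. *)
Definition low_degree (d : nat) : {set {ffun 'I_d -> 'I_3}} :=
  [set a : {ffun 'I_d -> 'I_3} | 3 * \sum_i a i <= 2 * d]%N.

(** Collecting terms by the monomial [g i] leaves one slice per element of [L], the shape required
    by [diag_tensor_slices]. *)
Lemma regroup_by_value (F : comNzRingType) (I J : finType) (g : I -> J) (L : {set J})
    (Q : pred I) (mon : J -> F) (h : I -> F) :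
  (forall i, Q i -> g i \in L) ->
  \sum_(i | Q i) mon (g i) * h i =
  \sum_(k < #|L|) mon (enum_val k) * \sum_(i | Q i && (g i == enum_val k)) h i.
Proof.
move=> QL; rewrite (partition_big g (mem L)) //= big_enum_val /=.
apply: eq_bigr => k _; rewrite mulr_sumr.
by apply: eq_bigr => i /andP[_ /eqP ->].
Qed.

(* The coefficients of [1 - (u + v + w)^2], the indicator function of [u + v + w = 0]. *)
Definition indicator_coef (s : 'I_3 * 'I_3 * 'I_3) : 'F_3 :=
  let k := (s.1.1 + s.1.2 + s.2)%N in
  if k == 0%N then 1 else
  if k == 2%N then
    if [|| s.1.1 == 2 :> nat, s.1.2 == 2 :> nat | s.2 == 2 :> nat]%N then -1 else -2
  else 0.

Lemma indicator_coefE (u v w : 'F_3) :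
  ((u + v + w == 0)%:R : 'F_3) =
  \sum_s indicator_coef s * (u ^+ s.1.1 * v ^+ s.1.2 * w ^+ s.2).
Proof.
transitivity (1 - (u + v + w) ^+ 2).
  by move: (u + v + w) => x; case: x => [[|[|[|x]]] hx] //; apply/val_inj.
pose G (s1 s2 s3 : 'I_3) : 'F_3 :=
  indicator_coef (s1, s2, s3) * (u ^+ s1 * v ^+ s2 * w ^+ s3).
transitivity (\sum_s1 \sum_s2 \sum_s3 G s1 s2 s3).
  rewrite !big_ord_recl !big_ord0 /G /indicator_coef /= /bump /=. ring.
rewrite pair_big /= pair_big /=.
by apply: eq_bigr => [[[s1 s2] s3]] _.
Qed.

Lemma indicator_coef_degree (s : 'I_3 * 'I_3 * 'I_3) :
  indicator_coef s != 0 -> (s.1.1 + s.1.2 + s.2 <= 2)%N.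
Proof.
by rewrite /indicator_coef; case: (_ + _)%N => [|[|[|k]]] //=; rewrite eqxx.
Qed.

(** With third points [- (p.1 + p.2)], the hypothesis makes the indicator of [x + y + z = 0] a
    diagonal tensor on [S]. It is a polynomial of degree at most [2 * d], so in each monomial one of
    the three factors has degree at most [2d/3]. This gives three families of [#|low_degree d|]
    slices. *)
Lemma tricolored_sum_free_bound (d : nat) (S : {set 'rV['F_3]_d * 'rV['F_3]_d}) :
  {in S & &, forall p1 p2 p3 : 'rV['F_3]_d * 'rV['F_3]_d,
    p1.1 + p2.2 - (p3.1 + p3.2) = 0 -> p1 = p2 /\ p2 = p3} ->
  (#|S| <= 3 * #|low_degree d|)%N.
Proof.
move=> Sfree.
pose m := #|S|; pose e (i : 'I_m) : 'rV_d * 'rV_d := enum_val i.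
pose x i := (e i).1; pose y i := (e i).2; pose z i := - ((e i).1 + (e i).2).
pose fA (f : {ffun 'I_d -> 'I_3 * 'I_3 * 'I_3}) := [ffun l => (f l).1.1].
pose fB (f : {ffun 'I_d -> 'I_3 * 'I_3 * 'I_3}) := [ffun l => (f l).1.2].
pose fC (f : {ffun 'I_d -> 'I_3 * 'I_3 * 'I_3}) := [ffun l => (f l).2].
pose cf (f : {ffun 'I_d -> 'I_3 * 'I_3 * 'I_3}) := \prod_l indicator_coef (f l).
pose mon (v : 'rV['F_3]_d) (a : {ffun 'I_d -> 'I_3}) := \prod_l v 0 l ^+ a l.
pose L := low_degree d.
have expand i j k : ((i == j) && (j == k))%:R =
    \sum_f cf f * (mon (x i) (fA f) * mon (y j) (fB f) * mon (z k) (fC f)).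
  transitivity (\prod_l ((x i 0 l + y j 0 l + z k 0 l == 0)%:R : 'F_3)).
    case: (altP (@andP (i == j) (j == k))) => [[/eqP-> /eqP->]|nij].
      rewrite big1 // => l _. by rewrite /x /y /z !mxE addrN eqxx.
    have : x i + y j + z k != 0.
      apply: contra nij => /eqP E0.
      have [/enum_val_inj -> /enum_val_inj ->] :=
        Sfree _ _ _ (enum_valP i) (enum_valP j) (enum_valP k) E0.
      by rewrite !eqxx.
    move=> /rV0Pn [l]; rewrite !mxE => nz.
    by rewrite (bigD1 l) //= [z k 0 l]mxE mxE (negPf nz) mul0r.
  under eq_bigr => l _ do rewrite indicator_coefE.
  rewrite bigA_distr_bigA /=; apply: eq_bigr => f _.
  rewrite !big_split /=; congr (_ * (_ * _ * _));
    by apply: eq_bigr => l _; rewrite ffunE.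
(* Each term is charged to the first of its three factors that has low degree. *)
pose QA f := fA f \in L.
pose QB f := ~~ QA f && (fB f \in L).
pose QC f := ~~ QA f && (fB f \notin L) && (fC f \in L).
have split3 (T : {ffun 'I_d -> 'I_3 * 'I_3 * 'I_3} -> 'F_3) :
   \sum_f cf f * T f = \sum_(f | QA f) cf f * T f + \sum_(f | QB f) cf f * T f
      + \sum_(f | QC f) cf f * T f.
  rewrite (bigID QA) /= -addrA; congr (_ + _).
  rewrite (bigID (fun f => fB f \in L)) /=; congr (_ + _).
  rewrite (bigID (fun f => fC f \in L)) /= [X in _ + X]big1 ?addr0 //.
  (* Three degrees above [2d/3] would add up to more than [2d], so the coefficient of a term charged
     to no factor vanishes. *)
  move=> f /andP[/andP[nA nB] nC]; rewrite (_ : cf f = 0) ?mul0r //.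
  apply/eqP; apply: contraT => /prodf_neq0 cf0.
  have : (\sum_l ((f l).1.1 + (f l).1.2 + (f l).2) <= \sum_(l < d) 2)%N.
    by apply: leq_sum => l _; apply: indicator_coef_degree; apply: cf0.
  rewrite !big_split /= sum_nat_const card_ord.
  move: nA nB nC; rewrite /QA !inE -!ltnNge.
  have degE (g : 'I_3 * 'I_3 * 'I_3 -> 'I_3) :
      (\sum_l [ffun l => g (f l)] l = \sum_l g (f l))%N.
    by apply: eq_bigr => l _; rewrite ffunE.
  rewrite (degE (fun s => s.1.1)) (degE (fun s => s.1.2)) (degE snd) => A1 A2 A3 A4.
  have := leq_add (leq_add A1 A2) A3; move: A4.
  by rewrite !addSn !addnS -!mulnDr => A4 A5; have := leq_trans A5 (leq_mul (leqnn 3) A4); lia.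
pose slice (Q : pred _) g (a : 'I_#|L|) T : 'F_3 :=
  \sum_(f : {ffun 'I_d -> 'I_3 * 'I_3 * 'I_3} | Q f && (g f == enum_val a)) cf f * T f.
apply: (@diag_tensor_slices 'F_3 m #|L|
  (fun a i => mon (x i) (enum_val a)) (fun a j => mon (y j) (enum_val a))
  (fun a l => mon (z l) (enum_val a))
  (fun a j l => slice QA fA a (fun f => mon (y j) (fB f) * mon (z l) (fC f)))
  (fun a i l => slice QB fB a (fun f => mon (x i) (fA f) * mon (z l) (fC f)))
  (fun a i j => slice QC fC a (fun f => mon (x i) (fA f) * mon (y j) (fB f)))).
move=> i j l; rewrite expand split3 /slice.
rewrite -(@regroup_by_value _ _ _ fA L QA (mon (x i))) //.
rewrite -(@regroup_by_value _ _ _ fB L QB (mon (y j))); last by move=> f /andP[].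
rewrite -(@regroup_by_value _ _ _ fC L QC (mon (z l))); last by move=> f /andP[].
by congr (_ + _ + _); apply: eq_bigr => f _; ring.
Qed.

(** * Collisions in random affine pullbacks *)

Lemma leq_bigsum_mem (T : eqType) (s : seq T) (F : T -> nat) (x : T) :
  x \in s -> (F x <= \sum_(y <- s) F y)%N.
Proof. by move=> xs; rewrite (big_rem x xs) /= leq_addr. Qed.

(** For [h] nonzero, [h *m psi] is uniform when [psi] is: [h] has a right inverse [k], and adding
    [k *m w] to [psi] translates [h *m psi] by [w]. *)
Lemma sum_mulmx_row (F : finFieldType) (d n : nat) (h : 'rV[F]_d) (f : 'rV[F]_n -> nat) :
  h != 0 ->
  (#|{: 'rV[F]_n}| * \sum_(psi : 'M[F]_(d, n)) f (h *m psi)%R =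
   #|{: 'M[F]_(d, n)}| * \sum_w f w)%N.
Proof.
move=> /rV0Pn [l hl].
pose k : 'cV[F]_d := (h 0 l)^-1 *: delta_mx l 0.
have hk : h *m k = 1%:M.
  rewrite /k -scalemxAr -colE; apply/matrixP=> i j.
  by rewrite !ord1 !mxE mulVf.
rewrite -[LHS]sum_nat_const -[RHS]sum_nat_const.
transitivity (\sum_(w : 'rV[F]_n) \sum_(psi : 'M[F]_(d, n)) f (h *m psi + w)%R)%N.
  apply: eq_bigr => w _; rewrite (reindex_inj (addIr (k *m w))) /=.
  by apply: eq_bigr => psi _; rewrite mulmxDr mulmxA hk mul1mx.
rewrite exchange_big /=; apply: eq_bigr => psi _.
by rewrite [RHS](reindex_inj (addrI (h *m psi))).
Qed.

(** Over [F_3], [x + y + z = 0] says that the triple is [(x, x + d, x + 2d)] for some [d], possibly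
    zero. The symmetric form treats the three points alike. *)
Definition zero_sum (n : nat) (A : {set 'rV['F_3]_n}) (x y : 'rV['F_3]_n) : bool :=
  [&& x \in A, y \in A & - (x + y) \in A].

Definition num_zero_sum (n : nat) (A : {set 'rV['F_3]_n}) : nat :=
  (\sum_x \sum_y zero_sum A x y)%N.

Definition zero_sum_degree (n : nat) (A : {set 'rV['F_3]_n}) (x : 'rV['F_3]_n) : nat :=
  (\sum_y zero_sum A x y)%N.

(* Moving a solution by [(c.1 *: h, c.2 *: h)] fixes its first, second, resp. third point. *)
Definition pinned_directions : seq ('F_3 * 'F_3) := [:: (0, 1); (1, 0); (1, -1)].

(** Along a pinned direction one point stays fixed while another runs over the whole space, so by
    symmetry the sum is the degree of the fixed point. *)
Lemma zero_sum_pinned (n : nat) (A : {set 'rV['F_3]_n}) (Delta : nat)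
    (c : 'F_3 * 'F_3) (x y : 'rV['F_3]_n) :
  (forall x, zero_sum_degree A x <= Delta)%N -> c \in pinned_directions ->
  (\sum_w zero_sum A (x + c.1 *: w) (y + c.2 *: w) <= Delta)%N.
Proof.
move=> le_Delta; rewrite !inE => /or3P[] /eqP-> /=.
- apply: leq_trans (le_Delta x); apply/eq_leq.
  rewrite /zero_sum_degree [RHS](reindex_inj (addrI y)) /=; apply: eq_bigr => w _.
  by rewrite scale0r addr0 scale1r.
- apply: leq_trans (le_Delta y); apply/eq_leq.
  rewrite /zero_sum_degree [RHS](reindex_inj (addrI x)) /=; apply: eq_bigr => w _.
  rewrite scale0r addr0 scale1r /zero_sum (addrC y).
  by rewrite andbCA.
- apply: leq_trans (le_Delta (- (x + y))); apply/eq_leq.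
  rewrite /zero_sum_degree [RHS](reindex_inj (addrI x)) /=; apply: eq_bigr => w _.
  rewrite scale1r scaleN1r /zero_sum.
  have -> : x + w + (y - w) = x + y by rewrite addrACA subrr addr0.
  have -> : - (- (x + y) + (x + w)) = y - w.
    by rewrite opprD opprK opprD addrACA subrr add0r.
  congr (nat_of_bool _); case: (_ \in A); case: (_ \in A); case: (_ \in A) => //.
Qed.

(** The pullback has independent offsets [p] and [r] for first and second points. Isolation excludes
    any other solution with the same [u], the same [v] or the same [u + v]. *)
Definition isolated (n : nat) (A : {set 'rV['F_3]_n}) (d : nat) (psi : 'M['F_3]_(d, n))
    (p r : 'rV['F_3]_n) (u v : 'rV['F_3]_d) : bool :=
  zero_sum A (p + u *m psi) (r + v *m psi) &&
  [forall h : 'rV['F_3]_d, (h != 0) ==> all (fun c : 'F_3 * 'F_3 =>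
     ~~ zero_sum A (p + (u + c.1 *: h) *m psi) (r + (v + c.2 *: h) *m psi))
     pinned_directions].

(** The isolated pairs are tricolored sum-free: if [u1 + v2 = u3 + v3], then [(u1, v2)] is itself a
    solution and shares a point with each of the three isolated ones, so it equals all of them. *)
Lemma num_isolated_le (n : nat) (A : {set 'rV['F_3]_n}) (d : nat) (psi : 'M['F_3]_(d, n))
    (p r : 'rV['F_3]_n) :
  (\sum_u \sum_v isolated A psi p r u v <= 3 * #|low_degree d|)%N.
Proof.
rewrite pair_big /=.
have -> : (\sum_w isolated A psi p r w.1 w.2 =
   #|[set w : 'rV['F_3]_d * 'rV['F_3]_d | isolated A psi p r w.1 w.2]|)%N.
  rewrite -sum1dep_card [RHS]big_mkcond /=; apply: eq_bigr => w _.
  by case: isolated.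
have pinned c u v : c \in pinned_directions -> isolated A psi p r u v ->
  forall u' v' h, u' = u + c.1 *: h -> v' = v + c.2 *: h ->
  zero_sum A (p + u' *m psi) (r + v' *m psi) -> h = 0.
  move=> cs /andP[_ /forallP iso] _ _ h -> -> good; apply/eqP.
  by apply: contraLR good => h0; have /implyP/(_ h0)/allP/(_ c cs) := iso h.
apply: tricolored_sum_free_bound => -[u1 v1] [u2 v2] [u3 v3].
rewrite !inE /= => iso1 iso2 iso3 /eqP; rewrite subr_eq0 => /eqP E.
have good : zero_sum A (p + u1 *m psi) (r + v2 *m psi).
  move: (iso1) (iso2) (iso3) => /andP[/and3P[A1 _ _] _] /andP[/and3P[_ A2 _] _].
  move=> /andP[/and3P[_ _ A3] _]; rewrite /zero_sum A1 A2 /=.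
  have -> // : p + u1 *m psi + (r + v2 *m psi) = p + u3 *m psi + (r + v3 *m psi).
  by rewrite addrACA -mulmxDl E mulmxDl addrACA.
have s1 : (0, 1) \in pinned_directions by [].
have s2 : (1, 0) \in pinned_directions by [].
have s3 : (1, -1) \in pinned_directions by [].
have ev : v2 = v1.
  apply: subr0_eq; apply: (pinned _ _ _ s1 iso1 u1 v2) good => /=.
    by rewrite scale0r addr0.
  by rewrite scale1r subrKC.
have eu : u1 = u2.
  apply: subr0_eq; apply: (pinned _ _ _ s2 iso2 u1 v2) good => /=.
    by rewrite scale1r subrKC.
  by rewrite scale0r addr0.
have e3 : u1 = u3.
  apply: subr0_eq; apply: (pinned _ _ _ s3 iso3 u1 v2) good => /=.
    by rewrite scale1r subrKC.
  by apply: (addrI u1); rewrite E scaleN1r opprB addrCA subrKC addrC.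
move: E; rewrite e3 => /addrI e4.
by rewrite -e4 -ev -eu e3.
Qed.

(** Put [N = 3 ^ n], [W = 3 ^ d], let [T] be the number of solutions, and average over [psi], [p],
    [r]. A pair [(u, v)] is a solution with probability [T / N ^ 2], and at most
    [3 * #|low_degree d|] pairs are isolated. Any other solution collides along one of 3 directions
    and fewer than [W] shifts, each with probability at most [T * Delta / N ^ 3]. Denominators are
    cleared by [N ^ 3]. *)
Lemma zero_sum_removal (n : nat) (A : {set 'rV['F_3]_n}) (d Delta : nat) :
  (forall x, zero_sum_degree A x <= Delta)%N ->
  (3 ^ n * (3 ^ d) ^ 2 * num_zero_sum A <=
   3 * (3 ^ n) ^ 3 * #|low_degree d| + 3 * (3 ^ d) ^ 3 * (num_zero_sum A * Delta))%N.
Proof.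
move=> le_Delta; set N := (3 ^ n)%N; set W := (3 ^ d)%N; set T := num_zero_sum A.
have cardV k : #|{: 'rV['F_3]_k}| = (3 ^ k)%N.
  by rewrite card_mx mul1n card_Fp.
have cN : #|{: 'rV['F_3]_n}| = N by exact: cardV.
have cW : #|{: 'rV['F_3]_d}| = W by exact: cardV.
pose Mx := #|{: 'M['F_3]_(d, n)}|.
have Mx0 : (0 < Mx)%N by apply/card_gt0P; exists 0.
pose good (t : 'M['F_3]_(d, n) * 'rV['F_3]_n * 'rV['F_3]_n) u v :=
  zero_sum A (t.1.2 + u *m t.1.1) (t.2 + v *m t.1.1).
pose iso (t : 'M['F_3]_(d, n) * 'rV['F_3]_n * 'rV['F_3]_n) u v :=
  isolated A t.1.1 t.1.2 t.2 u v.
have sum3 (g : 'M['F_3]_(d, n) -> 'rV['F_3]_n -> 'rV['F_3]_n -> nat) :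
    (\sum_t g t.1.1 t.1.2 t.2 = \sum_psi \sum_p \sum_r g psi p r)%N.
  by rewrite pair_bigA /= pair_bigA.
have totE : (\sum_u \sum_v \sum_t good t u v = W ^ 2 * (Mx * T))%N.
  rewrite -mulnn -mulnA -!cW.
  rewrite -sum_nat_const; apply: eq_bigr => u _.
  rewrite -sum_nat_const; apply: eq_bigr => v _.
  rewrite (sum3 (fun psi p r => zero_sum A (p + u *m psi) (r + v *m psi) : nat)).
  rewrite -sum_nat_const; apply: eq_bigr => psi _.
  rewrite /T /num_zero_sum [RHS](reindex_inj (addIr (u *m psi))) /=.
  apply: eq_bigr => p _.
  by rewrite [RHS](reindex_inj (addIr (v *m psi))).
have isosE : (\sum_u \sum_v \sum_t iso t u v <= Mx * (N * (N * (3 * #|low_degree d|))))%N.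
  under eq_bigr => u _ do rewrite exchange_big /=.
  rewrite exchange_big /=.
  rewrite (sum3 (fun psi p r => \sum_u \sum_v isolated A psi p r u v)%N).
  rewrite -[X in (_ <= X)%N]sum_nat_const; apply: leq_sum => psi _.
  rewrite -cN -[X in (_ <= X)%N]sum_nat_const; apply: leq_sum => p _.
  rewrite -[X in (_ <= X)%N]sum_nat_const; apply: leq_sum => r _.
  exact: num_isolated_le.
pose bad u v t := (\sum_(c <- pinned_directions) \sum_(h : 'rV['F_3]_d | (h != 0)%R)
  good t u v * good t (u + c.1 *: h)%R (v + c.2 *: h)%R)%N.
(* A collision along [h] consists of a solution and its shift by multiples of [h *m psi]. This
   vector is uniform since [h] is nonzero, and at most [Delta] of its [N] values give a solution. *)
have badE : (N * \sum_u \sum_v \sum_t bad u v t <=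
    W * (W * ((\sum_(c <- pinned_directions) 1) * (W * (Mx * (T * Delta))))))%N.
  rewrite big_distrr /= -cN -!cW -sum_nat_const; apply: leq_sum => u _.
  rewrite big_distrr /= -sum_nat_const; apply: leq_sum => v _.
  rewrite exchange_big big_distrl big_distrr /= big_seq [X in (_ <= X)%N]big_seq.
  apply: leq_sum => c cs; rewrite mul1n.
  rewrite exchange_big big_distrr /= -sum_nat_const.
  rewrite [X in (_ <= X)%N](bigID (fun h : 'rV['F_3]_d => h != 0)) /=.
  apply: leq_trans (leq_addr _ _); apply: leq_sum => h h0.
  pose f x y w : nat := zero_sum A (x + c.1 *: w) (y + c.2 *: w).
  have -> : (\sum_t good t u v * good t (u + c.1 *: h)%R (v + c.2 *: h)%R =
     \sum_x \sum_y zero_sum A x y * \sum_(psi : 'M['F_3]_(d, n)) f x y (h *m psi)%R)%N.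
    rewrite (sum3 (fun psi p r => (zero_sum A (p + u *m psi)%R (r + v *m psi)%R : nat) *
      zero_sum A (p + (u + c.1 *: h) *m psi)%R (r + (v + c.2 *: h) *m psi)%R)%N).
    under [RHS]eq_bigr => x _.
      under eq_bigr => y _ do rewrite big_distrr /=.
      rewrite exchange_big /=; over.
    rewrite [RHS]exchange_big /=; apply: eq_bigr => psi _.
    rewrite [RHS](reindex_inj (addIr (u *m psi))) /=; apply: eq_bigr => p _.
    rewrite [RHS](reindex_inj (addIr (v *m psi))) /=; apply: eq_bigr => r _.
    by rewrite /f !mulmxDl !addrA -!scalemxAl.
  rewrite /T /num_zero_sum big_distrr big_distrl big_distrr /=; apply: leq_sum => x _.
  rewrite big_distrr big_distrl big_distrr /=; apply: leq_sum => y _.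
  rewrite mulnCA sum_mulmx_row // mulnCA leq_mul2l leq_mul2l.
  by rewrite zero_sum_pinned ?orbT.
(* A solution that is not isolated has at least one collision. *)
have tot_le : (\sum_u \sum_v \sum_t good t u v <=
    \sum_u \sum_v \sum_t iso t u v + \sum_u \sum_v \sum_t bad u v t)%N.
  rewrite -big_split /=; apply: leq_sum => u _.
  rewrite -big_split /=; apply: leq_sum => v _.
  rewrite -big_split /=; apply: leq_sum => t _.
  rewrite /iso /isolated -/(good t u v) /bad.
  case: (boolP (good t u v)) => // gt; rewrite andTb.
  case: (boolP [forall h, _]) => // /forallPn [h].
  rewrite negb_imply => /andP[h0 /allPn [c cs]]; rewrite negbK => gh.
  have {gh} gh : good t (u + c.1 *: h) (v + c.2 *: h) by exact: gh.
  apply: leq_trans (leq_addl _ _).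
  have sum_h : (0 < \sum_(h : 'rV['F_3]_d | (h != 0)%R)
      true * good t (u + c.1 *: h)%R (v + c.2 *: h)%R)%N.
    by rewrite (bigD1 h h0) gh.
  exact: leq_trans sum_h (leq_bigsum_mem _ cs).
rewrite -(leq_pmul2l Mx0).
move: badE isosE tot_le; rewrite totE sum1_size /=.
move: (\sum_u _)%N (\sum_u _)%N => i b B I Le.
have := leq_mul (leqnn N) Le; rewrite mulnDr => Le'.
have := leq_trans Le' (leq_add (leq_mul (leqnn N) I) B).
by apply: etrans; congr (_ <= _)%N; ring.
Qed.

(** * The constant [gammaFP] and the exponent [C0] *)

(** [(1 + x + x ^+ 2) ^+ d] is the generating function of all exponent vectors; since [x < 1], each
    one of low degree contributes at least [x] to the power [2d/3]. *)
Lemma low_degree_chernoff (R : realType) (d : nat) (x : R) :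
  0 < x < 1 ->
  #|low_degree d|%:R <= ((1 + x + x ^+ 2) / powR x (2 / 3)) ^+ d.
Proof.
move=> /andP[x0 x1]; rewrite expr_div_n ler_pdivlMr ?exprn_gt0 ?powR_gt0 //.
have -> : (1 + x + x ^+ 2) ^+ d = \sum_(a : {ffun 'I_d -> 'I_3}) x ^+ (\sum_l a l)%N.
  transitivity (\prod_(l < d) \sum_(j < 3) x ^+ j).
    by rewrite prodr_const card_ord !big_ord_recl big_ord0 /= expr0 expr1 addr0 addrA.
  rewrite bigA_distr_bigA /=; apply: eq_bigr => a _.
  by rewrite -prodrXr.
rewrite (bigID (fun a => a \in low_degree d)) /= -[X in X <= _]addr0; apply: lerD; last first.
  by apply: sumr_ge0 => a _; rewrite exprn_ge0 // ltW.
rewrite [leLHS]mulr_natl -sumr_const.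
apply: ler_sum => a.
rewrite inE => deg_a.
rewrite -!powR_mulrn ?powR_ge0 ?(ltW x0) // -powRrM.
apply: ger_powR; first by rewrite x0 ltW.
rewrite -(ler_nat R) !natrM in deg_a; lra.
Qed.

Lemma has_lbound_gammaFP (R : realType) :
  has_inf [set (1 + x + x ^+ 2) / powR x (2 / 3) | x in [set x : R | 0 < x < 1]]%classic.
Proof.
split.
  by exists ((1 + 2^-1 + 2^-1 ^+ 2) / powR 2^-1 (2 / 3)); exists 2^-1 => //=; lra.
exists 0 => _ [x /= /andP[x0 x1] <-]; apply: divr_ge0; rewrite ?powR_ge0 //; nra.
Qed.

Lemma gammaFP_ge1 (R : realType) : 1 <= gammaFP R.
Proof.
apply: lb_le_inf; first by case: (has_lbound_gammaFP R).
move=> _ [x /= /andP[x0 x1] <-]; rewrite ler_pdivlMr ?powR_gt0 // mul1r.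
apply: (@le_trans _ _ 1); last by nra.
by rewrite -[leRHS](powRr0 x); apply: ger_powR; rewrite ?x0 ?ltW //; lra.
Qed.

Lemma gammaFP_lt3 (R : realType) : gammaFP R < 3.
Proof.
(* A rational point near the minimiser; cubing removes the fractional power and leaves
   [1.96^3 < 27 * 0.36]. *)
pose x : R := 3 / 5.
have x0 : 0 < x by rewrite /x; lra.
apply: (@le_lt_trans _ _ ((1 + x + x ^+ 2) / powR x (2 / 3))).
  apply: ge_inf; first by case: (has_lbound_gammaFP R).
  by exists x => //=; rewrite /x; lra.
rewrite ltr_pdivrMr ?powR_gt0 //.
have y3 : powR x (2 / 3) ^+ 3 = x ^+ 2.
  by rewrite -powR_mulrn ?powR_ge0 // -powRrM divfK ?pnatr_eq0 // powR_mulrn // ltW.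
have y0 := powR_gt0 (2 / 3) x0.
move: (powR x (2 / 3)) y3 y0 => y; rewrite /x => y3 y0.
have : ((1 + 3 / 5 + (3 / 5) ^+ 2) ^+ 3 : R) < (3 * y) ^+ 3.
  rewrite [ltRHS]exprMn y3; lra.
by rewrite ltr_pXn2r // nnegrE; lra.
Qed.

(** Taking [d]-th roots lets the bound, valid for each [x], pass to the infimum. The case [d = 0],
    where there is no root, is separate. *)
Lemma low_degree_le_gammaFP (R : realType) (d : nat) :
  #|low_degree d|%:R <= gammaFP R ^+ d.
Proof.
case: d => [|d].
  by apply: le_trans (low_degree_chernoff 0 (_ : 0 < 2^-1 < 1)) _; rewrite ?expr0 //; lra.
have d0 : d.+1%:R != 0 :> R by rewrite pnatr_eq0.
pose M : R := #|low_degree d.+1|%:R.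
have M0 : 0 <= M by rewrite ler0n.
have -> : #|low_degree d.+1|%:R = powR M d.+1%:R^-1 ^+ d.+1.
  by rewrite -powR_mulrn ?powR_ge0 // -powRrM mulVf // powRr1.
apply: lerXn2r; rewrite ?nnegrE ?powR_ge0 //.
  by rewrite (le_trans _ (gammaFP_ge1 R)).
apply: lb_le_inf; first by case: (has_lbound_gammaFP R).
move=> _ [x /= /andP[x0 x1] <-].
set g := (X in _ <= X).
have g0 : 0 <= g by apply: divr_ge0; rewrite ?powR_ge0 //; nra.
have -> : g = powR (g ^+ d.+1) d.+1%:R^-1.
  by rewrite -powR_mulrn // -powRrM mulfV // powRr1.
apply: ge0_ler_powR; rewrite ?nnegrE ?invr_ge0 ?exprn_ge0 ?ler0n //.
by apply: low_degree_chernoff; rewrite x0.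
Qed.

(** For [y > 0], write the power as [y * y^(p - 1)] and use [y^(p - 1) >= 1 + (p - 1) * ln y]
    together with [ln y >= 1 - 1 / y]. *)
Lemma bernoulli_powR (R : realType) (p y : R) : 1 <= p -> 0 <= y ->
  1 + p * (y - 1) <= powR y p.
Proof.
move=> p1; rewrite le_eqVlt => /orP[/eqP <-|y0].
  by rewrite powR0; [lra|apply: lt0r_neq0; lra].
have -> : powR y p = y * powR y (p - 1) by rewrite mulr_powRB1 ?ltW //; lra.
have ln_y : 1 - y^-1 <= ln y.
  have yV0 : 0 < y^-1 by rewrite invr_gt0.
  have := @le_ln1Dx R (y^-1 - 1); rewrite subrKC lnV ?posrE //.
  by move=> /(_ ltac:(lra)); lra.
have e1 : 1 + (p - 1) * ln y <= powR y (p - 1).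
  by rewrite /powR gt_eqF // expR_ge1Dx.
have yV : y * y^-1 = 1 by rewrite mulfV // gt_eqF.
have e2 : y * (1 + (p - 1) * ln y) <= y * powR y (p - 1) by rewrite ler_pM2l.
have e3 : (p - 1) * y * (1 - y^-1) <= (p - 1) * y * ln y.
  by apply: ler_wpM2l => //; apply: mulr_ge0; lra.
nra.
Qed.

Lemma ln3_gt0 (R : realType) : 0 < ln (3 : R).
Proof. by apply: ln_gt0; lra. Qed.

Lemma log_gammaFP_bounds (R : realType) : 0 <= ln (gammaFP R) / ln 3 < 1.
Proof.
rewrite divr_ge0 ?ln_ge0 ?gammaFP_ge1 ?ltW ?ln3_gt0 //=; last by rewrite ltr1n.
rewrite ltr_pdivrMr ?ln3_gt0 // mul1r ltr_ln ?posrE ?gammaFP_lt3 ?ltr0n //.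
exact: lt_le_trans ltr01 (gammaFP_ge1 R).
Qed.

Lemma C0_ge2 (R : realType) : 2 <= C0 R.
Proof.
have /andP[L0 L1] := log_gammaFP_bounds R; rewrite /C0.
have : 1 <= 1 / (1 - ln (gammaFP R) / ln 3) by rewrite ler_pdivlMr; lra.
lra.
Qed.

Lemma gammaFP_expn (R : realType) (d : nat) :
  gammaFP R ^+ d = powR ((3 ^ d)%N%:R) (ln (gammaFP R) / ln 3).
Proof.
have g0 : 0 < gammaFP R by exact: lt_le_trans ltr01 (gammaFP_ge1 R).
rewrite natrX -(@powR_mulrn _ 3) ?ler0n // powRAC powR_mulrn ?powR_ge0 //.
congr (_ ^+ _); rewrite /powR pnatr_eq0 /= divfK ?lnK ?posrE //.
by rewrite gt_eqF // ln3_gt0.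
Qed.

Lemma expn3_bracket (R : realType) (x : R) : 1 <= x ->
  exists d : nat, (3 ^ d)%N%:R <= x < (3 ^ d.+1)%N%:R.
Proof.
move=> x1.
have /andP[k_le k_gt] := truncn_itv (le_trans ler01 x1).
have k0 : (0 < Num.truncn x)%N by rewrite truncn_gt0.
have /andP[d_le d_gt] := @trunc_log_bounds 3 _ isT k0.
exists (trunc_log 3 (Num.truncn x)); apply/andP; split.
  by apply: le_trans k_le; rewrite ler_nat.
by apply: lt_le_trans k_gt _; rewrite ler_nat.
Qed.

(** * Supersaturation of zero sums up to a constant factor *)

Lemma num_zero_sum_remove (n : nat) (A : {set 'rV['F_3]_n}) (x : 'rV['F_3]_n) :
  (num_zero_sum (A :\ x) + zero_sum_degree A x <= num_zero_sum A)%N.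
Proof.
rewrite /num_zero_sum (bigD1 x) //= [X in (_ <= X)%N](bigD1 x) //= addnAC.
rewrite [X in (X + _ + _)%N]big1 ?add0n => [|y _]; last first.
  by rewrite /zero_sum !inE eqxx.
rewrite leq_add2l; apply: leq_sum => y _; apply: leq_sum => z _.
have sub w : w \in A :\ x -> w \in A by rewrite inE => /andP[].
have : zero_sum (A :\ x) y z -> zero_sum A y z.
  by move=> /and3P[/sub Ay /sub Az /sub Ayz]; apply/and3P.
by case: zero_sum => // ->.
Qed.

(** In characteristic 3 every point of [A] gives the constant solution [x + x + x = 0]. *)
Lemma card_le_num_zero_sum (n : nat) (A : {set 'rV['F_3]_n}) :
  (#|A| <= num_zero_sum A)%N.
Proof.
rewrite -sum1_card big_mkcond /=; apply: leq_sum => x _.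
case: ifP => // xA; rewrite (bigD1 x) //= /zero_sum xA.
have -> : - (x + x) = x; last by rewrite xA leq_addr.
apply/eqP; rewrite eq_sym -addr_eq0; apply/eqP/rowP => i; rewrite !mxE.
by case: (x 0 i) => [[|[|[|k]]] hk] //; apply/val_inj.
Qed.

(* With [W = 3^d] about [N / (6 Delta)], the collisions in [zero_sum_removal] are at most
   half of the solutions, and what remains is bounded by [gammaFP ^ d]. *)
Lemma zero_sum_regular (R : realType) (n : nat) (A : {set 'rV['F_3]_n}) :
  let C := C0 R in let c := 1 - ln (gammaFP R) / ln 3 in
  let N : R := (3 ^ n)%N%:R in let T : R := (num_zero_sum A)%:R in
  (0 < #|A|)%N ->
  (forall x, (zero_sum_degree A x)%:R <= C * T / #|A|%:R) ->
  N * #|A|%:R < 6 * C * T \/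
  T / N ^+ 2 * powR (#|A|%:R / N / (18 * C * (T / N ^+ 2))) (1 + c) <= 6.
Proof.
move=> C c N T A0 deg_le; have [lt|ge] := ltP (N * #|A|%:R) (6 * C * T); first by left.
right; set m : R := #|A|%:R in deg_le ge *.
have m0 : 0 < m by rewrite ltr0n.
have T0 : 0 < T by apply: lt_le_trans m0 _; rewrite ler_nat card_le_num_zero_sum.
have N0 : 0 < N by rewrite ltr0n expn_gt0.
have C0 : 0 < C by apply: lt_le_trans (C0_ge2 R); lra.
have CT0 : 0 < C * T by apply: mulr_gt0.
(* The bracketed quantity is at least 1 because the first alternative fails. *)
have [d /andP[W_le W_gt]] : exists d : nat,
    (3 ^ d)%N%:R <= N * m / (6 * C * T) < (3 ^ d.+1)%N%:R.
  by apply: expn3_bracket; rewrite ler_pdivlMr; lra.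
rewrite expnS natrM in W_gt; set W : R := (3 ^ d)%N%:R in W_le W_gt.
have W0 : 0 < W by rewrite ltr0n expn_gt0.
have W_C : W * (6 * C * T) <= N * m by rewrite -ler_pdivlMr //; lra.
have deg_nat x : (zero_sum_degree A x <= Num.truncn (C * T / m))%N.
  by rewrite truncn_ge_nat ?deg_le // divr_ge0 ?ltW.
have removal : N * W ^+ 2 * T <= 3 * N ^+ 3 * #|low_degree d|%:R +
    3 * W ^+ 3 * (T * (Num.truncn (C * T / m))%:R).
  rewrite /N /W /T -!natrX -!natrM -natrD ler_nat.
  exact: zero_sum_removal.
have M_le := low_degree_le_gammaFP R d; rewrite gammaFP_expn -/W in M_le.
rewrite (_ : ln _ / ln 3 = 1 - c) in M_le; last by rewrite /c; ring.
set M : R := #|_|%:R in removal M_le.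
have D_le : (Num.truncn (C * T / m))%:R <= C * T / m.
  by rewrite truncn_le divr_ge0 ?ltW.
set D : R := (Num.truncn _)%:R in removal D_le.
have WD : 6 * W * D <= N.
  apply: (@le_trans _ _ (6 * W * (C * T / m))).
    by apply: ler_wpM2l => //; lra.
  by rewrite mulrA ler_pdivrMr //; lra.
have WWT : 0 < W ^+ 2 * T by rewrite mulr_gt0 ?exprn_gt0.
have half : 3 * W ^+ 3 * (T * D) <= N * (W ^+ 2 * T) / 2.
  have := ler_wpM2l (ltW WWT) WD.
  have -> : W ^+ 2 * T * (6 * W * D) = 2 * (3 * W ^+ 3 * (T * D)) by ring.
  lra.
have NM : N ^+ 3 * M <= N ^+ 3 * powR W (1 - c) by rewrite ler_pM2l ?exprn_gt0.
have main : T * W ^+ 2 <= 6 * N ^+ 2 * powR W (1 - c).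
  rewrite -(ler_pM2l N0).
  have -> : N * (6 * N ^+ 2 * powR W (1 - c)) = 6 * (N ^+ 3 * powR W (1 - c)) by ring.
  lra.
have W2 : W ^+ 2 = powR W (1 + c) * powR W (1 - c).
  rewrite -powRD; last by rewrite (gt_eqF W0) /= implybT.
  by rewrite addrACA subrr addr0 -powR_mulrn ?ltW.
have P0 : 0 < powR W (1 - c) by rewrite powR_gt0.
rewrite W2 mulrA ler_pM2r // in main.
apply: (@le_trans _ _ (T / N ^+ 2 * powR W (1 + c))); last first.
  by rewrite mulrAC ler_pdivrMr ?exprn_gt0.
apply: ler_wpM2l; first by rewrite divr_ge0 ?exprn_ge0 ?ltW.
have c0 : 0 <= 1 + c by have := log_gammaFP_bounds R; rewrite /c; lra.
(* 18 is 6 times the factor 3 lost in rounding to a power of 3, so the base of the power is at most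
   [W]. *)
have -> : m / N / (18 * C * (T / N ^+ 2)) = N * m / (6 * C * T) / 3.
  by field; rewrite ?gt_eqF.
by apply: ge0_ler_powR; rewrite ?nnegrE //; lra.
Qed.

(** Induction on the size [m] of [A]. If some degree exceeds [C * T / m], deleting that point
    multiplies [T] by at most [1 - C / m], and [m ^ C] by at least as much by Bernoulli, so the
    ratio does not increase. Otherwise [zero_sum_regular] applies. *)
Lemma zero_sum_weak (R : realType) : exists2 K : R, 0 < K &
  forall (n : nat) (A : {set 'rV['F_3]_n}),
  K * (powR (#|A|%:R / (3 ^ n)%N%:R) (C0 R) * (3 ^ n)%N%:R ^+ 2) <= (num_zero_sum A)%:R.
Proof.
set C := C0 R; pose c := 1 - ln (gammaFP R) / ln 3.
have c0 : 0 < c by have := log_gammaFP_bounds R; rewrite /c; lra.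
have C2 : 2 <= C by exact: C0_ge2.
have CE : C = (1 + c) / c by rewrite /C /C0 -/c; field; rewrite gt_eqF.
(* With [del = T / N ^ 2], the second alternative of [zero_sum_regular] gives [(m / N)^(1 + c) <= 6
   * (18 * C)^(1 + c) * del^c]. Its [1 / c]-th power has exponent [(1 + c) / c = C] and constant
   [Q]; the first alternative costs [6 * C]. *)
pose Q := powR (6 * powR (18 * C) (1 + c)) c^-1.
have Q0 : 0 < Q by rewrite powR_gt0 // mulr_gt0 ?powR_gt0 //; lra.
pose K := Num.min (6 * C)^-1 Q^-1.
have K1 : K <= (6 * C)^-1 by rewrite ge_min lexx.
have K2 : K <= Q^-1 by rewrite ge_min lexx orbT.
have K0 : 0 < K by rewrite lt_min !invr_gt0 Q0 andbT; lra.
exists K => // n A; set N : R := (3 ^ n)%N%:R.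
have N0 : 0 < N by rewrite ltr0n expn_gt0.
elim: {A}#|A| {-2}A (erefl #|A|) => [|k IH] A cardA.
  by rewrite cardA mul0r powR0 ?mul0r ?mulr0 ?ler0n // gt_eqF //; lra.
set T : R := (num_zero_sum A)%:R; set m : R := #|A|%:R.
have m0 : 0 < m by rewrite ltr0n cardA.
have mT : m <= T by rewrite ler_nat card_le_num_zero_sum.
have e0 : 0 < m / N by rewrite divr_gt0.
have [] := boolP [forall x, (zero_sum_degree A x)%:R <= C * T / m].
  move=> /forallP deg_le.
  have [|lt|le6] := zero_sum_regular _ deg_le; first by rewrite cardA.
    have mN : m <= N.
      have := max_card (mem A); rewrite card_mx card_Fp // mul1n => le.
      by rewrite ler_nat.
    have e1 : powR (m / N) C <= m / N.
      by apply: ge1r_powR; [rewrite e0 ler_pdivrMr // mul1r|lra].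
    apply: (@le_trans _ _ ((6 * C)^-1 * (N * m))); last first.
      rewrite mulrC ler_pdivrMr; last lra.
      by apply: ltW; apply: lt_le_trans lt _; rewrite mulrC.
    apply: ler_pM => //; first exact: ltW.
      by rewrite mulr_ge0 ?powR_ge0 ?exprn_ge0 ?ltW.
    have -> : N * m = m / N * N ^+ 2 by field; rewrite gt_eqF.
    by rewrite ler_pM2r ?exprn_gt0.
  rewrite -/c -/m -/N -/T -/C in le6.
  set del := T / N ^+ 2 in le6.
  have del0 : 0 < del by rewrite divr_gt0 ?exprn_gt0 //; lra.
  have C18 : 0 < 18 * C by lra.
  suff : powR (m / N) C <= Q * del.
    move=> le_Q; apply: (@le_trans _ _ (Q^-1 * (Q * del * N ^+ 2))).
      apply: ler_pM => //; first exact: ltW.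
        by rewrite mulr_ge0 ?powR_ge0 ?exprn_ge0 ?ltW.
      by rewrite ler_pM2r ?exprn_gt0.
    by rewrite -mulrA mulKf ?gt_eqF // /del divfK // gt_eqF // exprn_gt0.
  have le_c : powR (m / N) (1 + c) <= 6 * powR (18 * C) (1 + c) * powR del c.
    have sp : powR (18 * C * del) (1 + c) = powR (18 * C) (1 + c) * (del * powR del c).
      rewrite powRM ?ltW // [powR del _]powRD; last by rewrite (gt_eqF del0) /= implybT.
      by rewrite powRr1 // ltW.
    have -> : powR (m / N) (1 + c) =
       powR (m / N / (18 * C * del)) (1 + c) * powR (18 * C * del) (1 + c).
      have z0 : 0 < 18 * C * del by exact: mulr_gt0.
      rewrite -powRM ?ltW // 1?divfK ?gt_eqF //; exact: divr_gt0.
    rewrite sp.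
    have -> : forall a b d e : R, a * (b * (d * e)) = (d * a) * (b * e) by move=> *; ring.
    rewrite -[6 * _ * _]mulrA; apply: ler_wpM2r => //.
    by rewrite mulr_ge0 ?powR_ge0.
  have -> : del = powR (powR del c) c^-1 by rewrite -powRrM mulfV ?gt_eqF // powRr1 // ltW.
  have Y0 : 0 <= 6 * powR (18 * C) (1 + c) by rewrite mulr_ge0 ?powR_ge0.
  have -> : powR (m / N) C = powR (powR (m / N) (1 + c)) c^-1 by rewrite CE powRrM.
  rewrite -(powRM _ Y0 (powR_ge0 del c)); apply: ge0_ler_powR le_c; rewrite ?nnegrE.
  - by rewrite invr_ge0 ltW.
  - exact: powR_ge0.
  - exact: mulr_ge0 Y0 (powR_ge0 _ _).
rewrite negb_forall => /existsP [x]; rewrite -ltNge => deg_gt.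
set deg : R := (zero_sum_degree A x)%:R in deg_gt.
have rem : (num_zero_sum (A :\ x))%:R + deg <= T.
  by rewrite -natrD ler_nat num_zero_sum_remove.
have degT : C * T / m < T.
  by apply: lt_le_trans deg_gt _; apply: le_trans rem; rewrite lerDr ler0n.
(* A degree is at most [T], so one above [C * T / m] forces [C < m]; the factor [1 - C / m] can then
   be cancelled at the end. *)
have Cm : C / m < 1.
  by rewrite -(@ltr_pM2r _ T) ?mul1r 1?mulrAC //; lra.
have xA : x \in A.
  apply: contraLR deg_gt => xA; rewrite -leNgt /deg /zero_sum_degree big1.
    by rewrite !divr_ge0 ?mulr_ge0 //; lra.
  by move=> y _; rewrite /zero_sum (negPf xA).
have cardA' : #|A :\ x| = k by move: cardA; rewrite (cardsD1 x A) xA => -[].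
have {IH} := IH _ cardA'.
have -> : #|A :\ x|%:R = m - 1 :> R.
  by rewrite cardA' /m cardA -natr1 addrK.
have -> : (m - 1) / N = (m / N) * (1 - m^-1) by field; rewrite !gt_eqF.
have m1 : 0 <= 1 - m^-1 by rewrite subr_ge0 invf_le1 // ler1n cardA.
rewrite powRM ?(ltW e0) // => IH.
have bern := @bernoulli_powR R C (1 - m^-1) ltac:(lra) m1.
have {}bern : 1 - C / m <= powR (1 - m^-1) C.
  by rewrite (_ : _ - _ = 1 + C * (1 - m^-1 - 1)) //; ring.
set E := powR (m / N) C in IH *.
have E0 : 0 <= K * (E * N ^+ 2) by rewrite !mulr_ge0 ?powR_ge0 ?exprn_ge0 ?ltW.
have IH' : K * (E * N ^+ 2) * (1 - C / m) <= T * (1 - C / m).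
  apply: (@le_trans _ _ (num_zero_sum (A :\ x))%:R).
    apply: le_trans IH.
    have -> : K * (E * powR (1 - m^-1) C * N ^+ 2) = K * (E * N ^+ 2) * powR (1 - m^-1) C.
      by ring.
    exact: ler_wpM2l.
  have -> : T * (1 - C / m) = T - C * T / m by ring.
  lra.
by rewrite -(@ler_pM2r _ (1 - C / m)) // subr_gt0.
Qed.

(** * Tensor powers *)

Definition set_square (n : nat) (A : {set 'rV['F_3]_n}) : {set 'rV['F_3]_(n + n)} :=
  [set w | (lsubmx w \in A) && (rsubmx w \in A)].

Lemma sum_row_mx (F : finNzRingType) (m n : nat) (f : 'rV[F]_(m + n) -> nat) :
  (\sum_w f w = \sum_x \sum_y f (row_mx x y))%N.
Proof.
rewrite pair_big /= (reindex (fun p : 'rV[F]_m * 'rV[F]_n => row_mx p.1 p.2)) //=.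
exists (fun w => (lsubmx w, rsubmx w)) => [[x y] _|w _] /=.
  by rewrite row_mxKl row_mxKr.
exact: hsubmxK.
Qed.

Lemma card_sum_mem (T : finType) (A : {set T}) : #|A| = (\sum_x (x \in A))%N.
Proof. by rewrite -sum1_card big_mkcond; apply: eq_bigr => x _; case: (x \in A). Qed.

Lemma card_set_square (n : nat) (A : {set 'rV['F_3]_n}) :
  #|set_square A| = (#|A| ^ 2)%N.
Proof.
rewrite card_sum_mem sum_row_mx -mulnn {1}card_sum_mem big_distrl /=.
apply: eq_bigr => x _; rewrite card_sum_mem big_distrr /=.
by apply: eq_bigr => y _; rewrite inE row_mxKl row_mxKr mulnb.
Qed.

Lemma num_zero_sum_square (n : nat) (A : {set 'rV['F_3]_n}) :
  num_zero_sum (set_square A) = (num_zero_sum A ^ 2)%N.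
Proof.
rewrite /num_zero_sum sum_row_mx -mulnn big_distrl /=; apply: eq_bigr => x _.
under eq_bigr => x' _ do rewrite sum_row_mx.
rewrite exchange_big /= big_distrl /=; apply: eq_bigr => y _.
rewrite big_distrr /=; apply: eq_bigr => x' _; rewrite big_distrr /=.
apply: eq_bigr => y' _; rewrite mulnb /zero_sum !inE add_row_mx opp_row_mx.
rewrite !row_mxKl !row_mxKr; congr (nat_of_bool _).
by case: (x \in A); case: (y \in A); case: (x' \in A); case: (y' \in A); case: (_ \in A).
Qed.

(* Tensor power trick: the ratio of both sides is multiplicative under [set_square], so the
   constant of [zero_sum_weak] can be removed. *)
Theorem zero_sum_supersaturation (R : realType) (n : nat) (A : {set 'rV['F_3]_n}) :
  powR (#|A|%:R / (3 ^ n)%N%:R : R) (C0 R) * (3 ^ n)%N%:R ^+ 2 <= (num_zero_sum A)%:R.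
Proof.
have [K K0 weak] := zero_sum_weak R.
pose S m (B : {set 'rV['F_3]_m}) : R :=
  powR (#|B|%:R / (3 ^ m)%N%:R) (C0 R) * (3 ^ m)%N%:R ^+ 2.
rewrite -/(S n A).
have S0 m (B : {set 'rV['F_3]_m}) : 0 <= S m B.
  by rewrite mulr_ge0 ?powR_ge0 ?exprn_ge0.
have Ssq m (B : {set 'rV['F_3]_m}) : S _ (set_square B) = S m B ^+ 2.
  have -> : S _ (set_square B) = powR (#|B|%:R / (3 ^ m)%N%:R * (#|B|%:R / (3 ^ m)%N%:R))
      (C0 R) * ((3 ^ m)%N%:R * (3 ^ m)%N%:R) ^+ 2.
    by rewrite /S card_set_square expnD -mulnn !natrM mulf_div.
  rewrite powRM ?divr_ge0 // /S; ring.
have power k : exists m, exists B : {set 'rV['F_3]_m},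
    S m B = S n A ^+ (2 ^ k) /\ (num_zero_sum B)%:R = (num_zero_sum A)%:R ^+ (2 ^ k) :> R.
  elim: k => [|k [m [B [SB TB]]]]; first by exists n, A; rewrite !expr1.
  exists (m + m)%N, (set_square B).
  by rewrite Ssq num_zero_sum_square natrX SB TB expnS mulnC !exprM.
have {}weak k : K * S n A ^+ (2 ^ k) <= (num_zero_sum A)%:R ^+ (2 ^ k).
  by have [m [B [<- <-]]] := power k; exact: weak.
set T : R := (num_zero_sum A)%:R in weak *.
rewrite leNgt; apply/negP => T_lt.
have T0 : 0 <= T by rewrite ler0n.
have SA0 : 0 < S n A by exact: le_lt_trans T_lt.
move: (S n A) SA0 T_lt weak => s s0 T_lt weak.
have [T_eq|T_neq] := eqVneq T 0.
  have := weak 0%N; rewrite !expr1 T_eq => le0.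
  by have := mulr_gt0 K0 s0; rewrite ltNge le0.
have {T_neq} T0' : 0 < T by rewrite lt_def T_neq.
pose r := s / T.
have r1 : 0 < r - 1 by rewrite subr_gt0 ltr_pdivlMr ?mul1r.
have r0 : 0 <= r by lra.
have r_le k : r ^+ k <= K^-1.
  apply: (@le_trans _ _ (r ^+ (2 ^ k))).
    by apply: ler_weXn2l; [lra|rewrite ltnW // ltn_expl].
  rewrite expr_div_n ler_pdivrMr ?exprn_gt0 //.
  by rewrite ler_pdivlMl.
(* By Bernoulli the powers of [r > 1] grow at least linearly, which contradicts the uniform bound
   [K^-1]. *)
have kr k : k.+1%:R * (r - 1) <= K^-1.
  apply: le_trans (r_le k.+1).
  have := @bernoulli_powR R k.+1%:R r; rewrite powR_mulrn // ler1n => /(_ isT r0).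
  lra.
have b0 : 0 <= K^-1 / (r - 1) by rewrite divr_ge0 ?invr_ge0 ?ltW.
have := archi_boundP b0; case: Num.bound => [|k]; first by rewrite ltNge b0.
by rewrite ltr_pdivrMr // ltNge kr.
Qed.

(** * Affine maps into [A], by induction on the dimension *)

Lemma sum_col_mx (F : finNzRingType) (s t n : nat) (f : 'M[F]_(s + t, n) -> nat) :
  (\sum_B f B = \sum_x \sum_y f (col_mx x y))%N.
Proof.
rewrite pair_big /= (reindex (fun p : 'M[F]_(s, n) * 'M[F]_(t, n) => col_mx p.1 p.2)) //=.
exists (fun w => (usubmx w, dsubmx w)) => [[x y] _|w _] /=.
  by rewrite col_mxKu col_mxKd.
exact: vsubmxK.
Qed.

Definition maps_into (F : finFieldType) (t n : nat) (A : {set 'rV[F]_n})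
    (x : 'rV[F]_n) (B : 'M[F]_(t, n)) : bool :=
  [forall u : 'rV[F]_t, x + u *m B \in A].

Definition num_affine_maps (F : finFieldType) (t n : nat) (A : {set 'rV[F]_n}) : nat :=
  (\sum_x \sum_(B : 'M[F]_(t, n)) maps_into A x B)%N.

Definition line_core (F : finFieldType) (n : nat) (A : {set 'rV[F]_n}) (v : 'rV[F]_n) :
    {set 'rV[F]_n} :=
  [set x | [forall c : F, x + c *: v \in A]].

(** Splitting off the first row [v] of the matrix: the remaining rows give an affine map into the
    intersection of the translates of [A] along [v]. *)
Lemma num_affine_mapsS (F : finFieldType) (t n : nat) (A : {set 'rV[F]_n}) :
  num_affine_maps t.+1 A = (\sum_v num_affine_maps t (line_core A v))%N.
Proof.
rewrite /num_affine_maps [RHS]exchange_big /=; apply: eq_bigr => x _.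
rewrite (@sum_col_mx F 1 t n); apply: eq_bigr => v _; apply: eq_bigr => B _.
congr (nat_of_bool _); apply/forallP/forallP => [AB u|AB u].
  rewrite inE; apply/forallP => c; have := AB (row_mx (c%:M : 'M_1) u).
  have -> : row_mx (c%:M : 'M_1) u *m col_mx v B = c *: v + u *m B.
    exact: etrans (mul_row_col _ _ _ _) (congr1 (+%R^~ _) (mul_scalar_mx _ _)).
  by rewrite addrA addrAC.
pose u1 : 'M_1 := @lsubmx F 1 1 t u; pose u2 : 'rV_t := @rsubmx F 1 1 t u.
have -> : u *m col_mx v B = u1 0 0 *: v + u2 *m B.
  rewrite -mul_scalar_mx -mx11_scalar; apply: etrans (mul_row_col _ _ _ _).
  by congr (_ *m _); rewrite hsubmxK.
have := AB u2; rewrite inE => /forallP /(_ (u1 0 0)).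
by rewrite addrA addrAC.
Qed.

Lemma num_affine_maps0 (F : finFieldType) (n : nat) (A : {set 'rV[F]_n}) :
  num_affine_maps 0 A = #|A|.
Proof.
rewrite card_sum_mem; apply: eq_bigr => x _.
rewrite (bigD1 0) //= big1 ?addn0 => [|B /eqP[]]; last by rewrite flatmx0.
congr (nat_of_bool _); apply/forallP/idP => [/(_ 0)|xA u].
  by rewrite mulmx0 addr0.
by rewrite mulmx0 addr0.
Qed.

(** Jensen by the tangent line at the mean [mu], which is Bernoulli at [a i / mu]. The case [mu = 0]
    also covers an empty [I]. *)
Lemma power_mean (R : realType) (I : finType) (a : I -> R) (p : R) :
  1 <= p -> (forall i, 0 <= a i) ->
  #|I|%:R * powR ((\sum_i a i) / #|I|%:R) p <= \sum_i powR (a i) p.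
Proof.
move=> p1 a0; set mu := _ / _.
have mu0 : 0 <= mu by rewrite divr_ge0 // sumr_ge0.
have [-> |mu_neq] := eqVneq mu 0.
  rewrite powR0 ?mulr0; last by rewrite gt_eqF; lra.
  by apply: sumr_ge0 => i _; rewrite powR_ge0.
have {mu0 mu_neq} mu0 : 0 < mu by rewrite lt_def mu_neq.
have I0 : #|I|%:R != 0 :> R.
  by apply: contraTneq mu0 => I0; rewrite /mu I0 invr0 mulr0 ltxx.
have tangent i : powR mu p * (1 + p * (a i / mu - 1)) <= powR (a i) p.
  have am0 : 0 <= a i / mu by apply: divr_ge0 => //; exact: ltW.
  have -> : powR (a i) p = powR mu p * powR (a i / mu) p.
    by rewrite -powRM ?(ltW mu0) // mulrC divfK // gt_eqF.
  by apply: ler_wpM2l; rewrite ?powR_ge0 // bernoulli_powR.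
apply: le_trans (ler_sum _ (fun i _ => tangent i)).
rewrite -mulr_sumr big_split /= -mulr_sumr big_split /= -mulr_suml !sumr_const.
have -> : (\sum_i a i) = mu * #|I|%:R by rewrite /mu divfK.
rewrite -[1 *+ _]/(#|I|%:R) mulNrn [_ * _ / mu]mulrAC divff ?gt_eqF // mul1r subrr.
by rewrite mulr0 addr0 mulrC.
Qed.

(** The hypothesis says that the cores have average density at least [alpha ^ s]. Induction raises
    each core density to the power [s ^+ t], and convexity moves the average inside that power. *)
Lemma num_affine_maps_ge (R : realType) (F : finFieldType) (s : R) :
  1 <= s ->
  (forall (n : nat) (A : {set 'rV[F]_n}),
     powR (#|A|%:R / (#|F| ^ n)%N%:R) s * (#|F| ^ n)%N%:R ^+ 2 <=
     (\sum_v #|line_core A v|)%N%:R) ->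
  forall (t n : nat) (A : {set 'rV[F]_n}),
  powR (#|A|%:R / (#|F| ^ n)%N%:R) (s ^+ t) * (#|F| ^ n)%N%:R ^+ t.+1 <=
  (num_affine_maps t A)%:R.
Proof.
move=> s1 base; have F0 : (0 < #|F|)%N by apply/card_gt0P; exists 0.
elim=> [|t IH] n A; set N : R := (#|F| ^ n)%N%:R.
  rewrite num_affine_maps0 expr0 powRr1 ?divr_ge0 // expr1 divfK //.
  by rewrite pnatr_eq0 -lt0n expn_gt0 F0.
have N0 : 0 < N by rewrite ltr0n expn_gt0 F0.
rewrite num_affine_mapsS natr_sum.
apply: le_trans (ler_sum _ (fun v _ => IH n (line_core A v))).
rewrite -mulr_suml exprS [N ^+ t.+2]exprS mulrA.
apply: ler_wpM2r; first by rewrite exprn_ge0 // ltW.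
have p1 : 1 <= s ^+ t by rewrite exprn_ege1.
have := @power_mean R _ (fun v => #|line_core A v|%:R / N) _ p1.
rewrite card_mx mul1n -/N => pm.
apply: le_trans (pm _); last by move=> v; rewrite divr_ge0 // ltW.
rewrite mulrC; apply: ler_wpM2l; first exact: ltW.
rewrite powRrM; apply: ge0_ler_powR.
- by apply: le_trans p1.
- by rewrite nnegrE powR_ge0.
- by rewrite nnegrE -mulr_suml !divr_ge0 ?sumr_ge0 // ltW.
- by rewrite -mulr_suml -natr_sum -mulrA -invfM ler_pdivlMr ?mulr_gt0 // -expr2.
Qed.

(** Over [F_2] a line is [x, x + v], so every ordered pair of points of [A] counts once; hence the
    exponent 2. *)
Lemma sum_line_core_F2 (n : nat) (A : {set 'rV['F_2]_n}) :
  (\sum_v #|line_core A v| = #|A| ^ 2)%N.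
Proof.
under eq_bigr => v _ do rewrite card_sum_mem.
rewrite exchange_big /= -mulnn {1}card_sum_mem big_distrl /=.
apply: eq_bigr => x _; rewrite card_sum_mem big_distrr /=.
rewrite [RHS](reindex_inj (addrI x)) /=; apply: eq_bigr => v _.
rewrite mulnb inE; congr (nat_of_bool _); apply/forallP/andP => [AB|[xA xvA] c].
  by have := AB 0; have := AB 1; rewrite scale1r scale0r addr0.
case: c => [[|[|k]] hk] //.
  by rewrite (_ : Ordinal hk = 0) ?scale0r ?addr0 //; apply/val_inj.
by rewrite (_ : Ordinal hk = 1) ?scale1r //; apply/val_inj.
Qed.

(** Since [3 = 0], the third point [- (x + (x + v))] is [x + 2 *: v]. *)
Lemma sum_line_core_F3 (n : nat) (A : {set 'rV['F_3]_n}) :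
  (\sum_v #|line_core A v| = num_zero_sum A)%N.
Proof.
under eq_bigr => v _ do rewrite card_sum_mem.
rewrite exchange_big /=; apply: eq_bigr => x _.
rewrite [RHS](reindex_inj (addrI x)) /=; apply: eq_bigr => v _.
rewrite inE; congr (nat_of_bool _).
have third : - (x + (x + v)) = x + 2 *: v.
  apply/rowP => i; rewrite !mxE; move: (x 0 i) (v 0 i) => a b.
  have three : (3 : 'F_3) = 0 by apply/val_inj.
  rewrite -[RHS]addr0 -(mul0r (a + b)) -oppr0 -three; ring.
rewrite /zero_sum third; apply/forallP/and3P => [AB|[A0 A1 A2] c].
  by have := AB 0; have := AB 1; have := AB 2; rewrite scale1r scale0r addr0.
case: c => [[|[|[|k]]] hk] //.
- by rewrite (_ : Ordinal hk = 0) ?scale0r ?addr0 //; apply/val_inj.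
- by rewrite (_ : Ordinal hk = 1) ?scale1r //; apply/val_inj.
- by rewrite (_ : Ordinal hk = 2) //; apply/val_inj.
Qed.

(** * Affinely dependent tuples *)

(** Only the images of the origin and of the standard basis are tested, so these pairs are the
    [(t + 1)]-tuples of points of [A]. *)
Definition vertices_in (F : finFieldType) (t n : nat) (A : {set 'rV[F]_n})
    (x : 'rV[F]_n) (B : 'M[F]_(t, n)) : bool :=
  (x \in A) && [forall i, x + row i B \in A].

Lemma vertices_in_col_mx (F : finFieldType) (t n : nat) (A : {set 'rV[F]_n})
    (x v : 'rV[F]_n) (B : 'M[F]_(t, n)) :
  vertices_in A x (col_mx v B) = (x + v \in A) && vertices_in A x B.
Proof.
rewrite /vertices_in andbCA; congr (_ && _); apply/forallP/andP => [AB|[xv /forallP AB] i].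
  split; first by have := AB (lshift _ 0); rewrite rowKu row_id.
  by apply/forallP => i; have := AB (rshift _ i); rewrite rowKd.
by case: (split_ordP i) => j ->; rewrite ?rowKd // rowKu ord1 row_id.
Qed.

Lemma sum_translate_mem (F : finFieldType) (n : nat) (A : {set 'rV[F]_n}) (x : 'rV[F]_n) :
  (\sum_v (x + v \in A)%R = #|A|)%N.
Proof. by rewrite card_sum_mem [RHS](reindex_inj (addrI x)). Qed.

Lemma sum_vertices_in (F : finFieldType) (t n : nat) (A : {set 'rV[F]_n}) :
  (\sum_x \sum_(B : 'M[F]_(t, n)) vertices_in A x B = #|A| ^ t.+1)%N.
Proof.
elim: t => [|t IH].
  rewrite expn1 card_sum_mem; apply: eq_bigr => x _.
  rewrite (bigD1 0) //= big1 ?addn0 => [|B /eqP[]]; last by rewrite flatmx0.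
  by rewrite /vertices_in; congr (nat_of_bool _); rewrite andb_idr // => _; apply/forallP => -[].
rewrite expnS -IH big_distrr /=; apply: eq_bigr => x _.
rewrite (@sum_col_mx F 1 t n) exchange_big big_distrr /=; apply: eq_bigr => B _.
under eq_bigr => v _ do rewrite vertices_in_col_mx -mulnb.
by rewrite -big_distrl /= sum_translate_mem.
Qed.

Lemma card_row_space_le (F : finFieldType) (t n : nat) (B : 'M[F]_(t, n)) :
  (\sum_(v : 'rV[F]_n) (v <= B)%MS <= #|F| ^ t)%N.
Proof.
have -> : (\sum_(v : 'rV[F]_n) (v <= B)%MS = #|[set v : 'rV[F]_n | (v <= B)%MS]|)%N.
  by rewrite card_sum_mem; apply: eq_bigr => v _; rewrite inE.
have -> : (#|F| ^ t = #|[set: 'rV[F]_t]|)%N by rewrite cardsT card_mx mul1n.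
apply: leq_trans (leq_imset_card (fun u : 'rV[F]_t => u *m B) [set: 'rV[F]_t]).
apply: subset_leq_card; apply/fintype.subsetP => v; rewrite inE => /submxP [u ->].
by apply: imset_f.
Qed.

(** A dependent tuple extends a dependent one, or its new row lies in the old row space, which has
    at most [q^t] elements for [q = #|F|]. The bound [(q^t - 1) * #|A|^t] propagates because
    [2 * q^t <= q^(t + 1)]; it is stated additively to avoid truncated subtraction. *)
Lemma degenerate_vertices (F : finFieldType) (t n : nat) (A : {set 'rV[F]_n}) :
  (\sum_x \sum_(B : 'M[F]_(t, n)) (vertices_in A x B && (\rank B < t)) + #|A| ^ t <=
   #|F| ^ t * #|A| ^ t)%N.
Proof.
have F1 : (1 < #|F|)%N.
  by rewrite (cardD1 0) (cardD1 1) !inE oner_eq0.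
elim: t => [|t IH].
  by rewrite !expn0 muln1 big1 // => x _; rewrite big1 // => B _; rewrite ltn0 andbF.
pose deg := (\sum_x \sum_(B : 'M[F]_(t, n)) (vertices_in A x B && (\rank B < t)))%N.
have step : (\sum_x \sum_(B : 'M[F]_(t.+1, n)) (vertices_in A x B && (\rank B < t.+1)) <=
    #|A| * deg + #|F| ^ t * #|A| ^ t.+1)%N.
  rewrite -(sum_vertices_in t A) /deg !big_distrr -big_split /=; apply: leq_sum => x _.
  rewrite (@sum_col_mx F 1 t n) exchange_big !big_distrr -big_split /=; apply: leq_sum => B _.
  apply: (@leq_trans (\sum_v ((x + v \in A)%R * (vertices_in A x B && (\rank B < t)) +
     (v <= B)%MS * vertices_in A x B)))%N.
    apply: leq_sum => v _; rewrite vertices_in_col_mx.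
    case: (x + v \in A) => //; case: (vertices_in A x B) => //=.
    rewrite muln1 mul1n; have [vB|vB] := boolP (v <= B)%MS.
      by rewrite (leq_trans (leq_b1 _)) // leq_addl.
    rewrite addn0; have [rk|//] := ltnP (\rank (col_mx v B)) t.+1.
    have : (B < col_mx v B)%MS.
      rewrite ltmxE -addsmxE addsmxSr; apply: contra vB.
      by rewrite -addsmxE addsmx_sub => /andP[].
    by move=> /rank_ltmx lt; rewrite (leq_trans lt).
  rewrite big_split /= -!big_distrl /= sum_translate_mem leq_add2l leq_mul2r.
  by rewrite card_row_space_le orbT.
apply: (@leq_trans (#|A| * deg + #|F| ^ t * #|A| ^ t.+1 + #|A| ^ t.+1)).
  by rewrite leq_add2r.
rewrite addnAC expnS -mulnDr.
apply: (@leq_trans (#|A| * (#|F| ^ t * #|A| ^ t) + #|F| ^ t * (#|A| * #|A| ^ t))).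
  by rewrite leq_add2r leq_mul2l IH orbT.
rewrite mulnCA addnn -mul2n expnS -mulnA leq_mul2r F1 orbT //.
Qed.

(** A rank-deficient map into [A] sends the vertices into [A], so it is among the dependent
    tuples. *)
Lemma num_affine_maps_split (F : finFieldType) (t n : nat) (A : {set 'rV[F]_n}) :
  (num_affine_maps t A <=
   #|[set w : 'rV[F]_n * 'M[F]_(t, n) | (\rank w.2 == t) && maps_into A w.1 w.2]| +
   \sum_x \sum_(B : 'M[F]_(t, n)) (vertices_in A x B && (\rank B < t)))%N.
Proof.
rewrite card_sum_mem /num_affine_maps !pair_big -big_split /=; apply: leq_sum => -[x B] _.
rewrite inE /=; case: (boolP (maps_into A x B)) => // /forallP AB.
have -> : vertices_in A x B.
  rewrite /vertices_in; have := AB 0; rewrite mul0mx addr0 => -> /=.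
  by apply/forallP => i; rewrite rowE.
by have := rank_leq_row B; rewrite leq_eqVlt andbT; case: eqP => // _ /= ->.
Qed.

(** * From affine maps to affine subspaces *)

(** Any two parametrisations of [S] differ by an affine automorphism of the parameter space. *)
Lemma card_affine_param_le (q t n : nat) (S : {set 'rV['F_q]_n}) :
  (#|[set w : 'rV['F_q]_n * 'M['F_q]_(t, n) | (\rank w.2 == t) &&
       ([set w.1 + u *m w.2 | u : 'rV['F_q]_t] == S)%R]| <= #|Aut_aff q t|)%N.
Proof.
set P := [set w | _].
have [->|[w1]] := set_0Vmem P; first by rewrite cards0.
rewrite inE => /andP[_ /eqP SE].
pose x1 := w1.1; pose B1 := w1.2.
(* Composing the fixed parametrisation with [f] and reading off the images of the origin and the
   basis vectors recovers [(x, B)]. *)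
pose back (f : {ffun 'rV['F_q]_t -> 'rV['F_q]_t}) : 'rV['F_q]_n * 'M['F_q]_(t, n) :=
  (x1 + f 0 *m B1, \matrix_i ((f (delta_mx 0 i) - f 0) *m B1)).
apply: leq_trans (leq_imset_card back (Aut_aff q t)); apply: subset_leq_card.
apply/fintype.subsetP => -[x B]; rewrite inE /= => /andP[rkB /eqP SB].
have param u : (x + u *m B - x1 <= B1)%MS.
  have : x + u *m B \in S by rewrite -SB; apply: imset_f.
  by rewrite -SE => /imsetP [u' _ ->]; rewrite addrC addKr submxMl.
have xB1 : (x - x1 <= B1)%MS by have := param 0; rewrite mul0mx addr0.
have BB1 : (B <= B1)%MS.
  apply/row_subP => i; have -> : row i B = (x + delta_mx 0 i *m B - x1) - (x - x1).
    by rewrite -rowE opprB addrA subrK addrC addKr.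
  by rewrite addmx_sub // eqmx_opp.
have [M ME] := submxP BB1; have [b bE] := submxP xB1.
apply/imsetP; exists [ffun u => u *m M + b].
  rewrite inE; apply/andP; split; first by apply/existsP; exists M; apply/existsP; exists b.
  apply/injectiveP => u u'; rewrite !ffunE => /addIr uM.
  have /row_free_inj : row_free B by exact: rkB.
  by apply; rewrite ME !mulmxA uM.
rewrite /back !ffunE mul0mx add0r -bE subrKC; congr (_, _).
apply/row_matrixP => i; rewrite rowK !ffunE addrK -mulmxA -ME -rowE //.
Qed.

Lemma num_aff_in_ge (q t n : nat) (A : {set 'rV['F_q]_n}) :
  (#|[set w : 'rV['F_q]_n * 'M['F_q]_(t, n) | (\rank w.2 == t) && maps_into A w.1 w.2]| <=
   num_aff_in t A * #|Aut_aff q t|)%N.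
Proof.
set P := [set w | _].
pose im (w : 'rV['F_q]_n * 'M['F_q]_(t, n)) := [set w.1 + u *m w.2 | u : 'rV['F_q]_t].
rewrite /num_aff_in; set Fam := [set S | _].
have PF w : w \in P -> im w \in Fam.
  rewrite !inE => /andP[rk /forallP wA]; apply/andP; split.
    by apply/existsP; exists w.1; apply/existsP; exists w.2; rewrite rk eqxx.
  by apply/fintype.subsetP => _ /imsetP [u _ ->].
rewrite -sum1_card (partition_big im (mem Fam)) //= -sum_nat_const.
apply: leq_sum => S _; rewrite sum1dep_card.
apply: leq_trans (card_affine_param_le t S); apply: subset_leq_card.
by apply/fintype.subsetP => w; rewrite !inE => /andP[/andP[-> _] ->].
Qed.

Lemma Aut_aff_gt0 (q t : nat) : (0 < #|Aut_aff q t|)%N.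
Proof.
apply/card_gt0P; exists [ffun x => x]; rewrite inE; apply/andP; split.
  apply/existsP; exists 1%:M; apply/existsP; exists 0; apply/eqP/ffunP => x.
  by rewrite !ffunE mulmx1 addr0.
by apply/injectiveP => x y; rewrite !ffunE.
Qed.

(** * The exponent [sigma] and the final estimates *)

Lemma sigma_ge2 (R : realType) (q : nat) : 2 <= sigma R q.
Proof. by rewrite /sigma; case: ifP => // _; exact: C0_ge2. Qed.

Lemma sigma_expn_gt (R : realType) (q t : nat) : 0 < sigma R q ^+ t - t%:R.
Proof.
rewrite subr_gt0; apply: (@lt_le_trans _ _ (2 ^+ t)).
  by rewrite -natrX ltr_nat ltn_expl.
by apply: lerXn2r; rewrite ?nnegrE ?sigma_ge2 //; apply: le_trans (sigma_ge2 R q).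
Qed.

Lemma num_affine_maps_ge_sigma (R : realType) (q : nat) (hq : q = 2%N \/ q = 3%N)
    (t n : nat) (A : {set 'rV['F_q]_n}) :
  powR (#|A|%:R / (q ^ n)%N%:R) (sigma R q ^+ t) * (q ^ n)%N%:R ^+ t.+1 <=
  (num_affine_maps t A)%:R.
Proof.
have pq : prime q by case: hq => ->.
have s1 : 1 <= sigma R q by apply: le_trans (sigma_ge2 R q); rewrite ler1n.
suff base : forall (n : nat) (A : {set 'rV['F_q]_n}),
     powR (#|A|%:R / (#|'F_q| ^ n)%N%:R) (sigma R q) * (#|'F_q| ^ n)%N%:R ^+ 2 <=
     (\sum_v #|line_core A v|)%N%:R.
  by have := num_affine_maps_ge s1 base t A; rewrite card_Fp.
move=> {n A} n A; rewrite card_Fp //; case: hq A {pq s1} => -> A.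
  rewrite sum_line_core_F2 /sigma eqxx powR_mulrn ?divr_ge0 // -exprMn divfK -?natrX //.
  by rewrite pnatr_eq0 expn_eq0.
by rewrite sum_line_core_F3; exact: zero_sum_supersaturation.
Qed.

(** Strictness comes from the extra term [#|A| ^ t] in [degenerate_vertices], which is positive for
    nonempty [A]. *)
Lemma num_aff_in_supersaturation (R : realType) (q : nat) (hq : q = 2%N \/ q = 3%N)
    (t n : nat) (A : {set 'rV['F_q]_n}) :
  (0 < #|A|)%N ->
  powR (#|A|%:R / (q ^ n)%N%:R : R) (sigma R q ^+ t) * (q ^ n)%N%:R ^+ t.+1 <
  (num_aff_in t A)%:R * #|Aut_aff q t|%:R + (q ^ t)%N%:R * #|A|%:R ^+ t.
Proof.
move=> A0; have pq : prime q by case: hq => ->.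
apply: le_lt_trans (num_affine_maps_ge_sigma R hq t A) _.
rewrite -natrX -!natrM -natrD ltr_nat.
apply: leq_ltn_trans (num_affine_maps_split t A) _.
apply: leq_ltn_trans (leq_add (num_aff_in_ge t A) (leqnn _)) _.
have := degenerate_vertices t A; rewrite card_Fp // ltn_add2l; apply: leq_trans.
by rewrite -addn1 leq_add2l expn_gt0 A0.
Qed.

Theorem theorem4p2 (R : realType) (q : nat) (hq : q = 2%N \/ q = 3%N) (t : nat) :
  (forall n : nat,
     ((ex_aff q n t)%:R : R) <
       powR (q%:R : R)
         (n%:R - (n%:R - t%:R) / (sigma R q ^+ t - t%:R)))
  /\
  (forall (n : nat) (A : {set 'rV['F_q]_n}) (D : R),
     0 < D ->
     (#|A|%:R : R) =
       D * powR (q%:R : R) ((1 - 1 / (sigma R q ^+ t - t%:R)) * n%:R) ->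
     let N : R := (q ^ n)%N%:R in
     let alpha : R := #|A|%:R / N in
     (1 - (q ^ t)%N%:R / powR D (sigma R q ^+ t - t%:R))
       * powR alpha (sigma R q ^+ t) * N ^+ t.+1 / (#|Aut_aff q t|%:R : R)
     < (num_aff_in t A)%:R).
Proof.
have q1 : 1 < q%:R :> R by rewrite ltr1n; case: hq => ->.
have q0 : 0 < q%:R :> R by exact: lt_trans q1.
set s := sigma R q ^+ t - t%:R.
have s0 : 0 < s by exact: sigma_expn_gt.
have count n (A : {set 'rV['F_q]_n}) (D : R) : 0 < D ->
    (#|A|%:R : R) = D * powR (q%:R : R) ((1 - 1 / s) * n%:R) ->
    (1 - (q ^ t)%N%:R / powR D s) * powR (#|A|%:R / (q ^ n)%N%:R) (sigma R q ^+ t)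
      * (q ^ n)%N%:R ^+ t.+1 / (#|Aut_aff q t|%:R : R) < (num_aff_in t A)%:R.
  move=> D0 AE; set N : R := (q ^ n)%N%:R.
  have NE : N = powR q%:R n%:R by rewrite /N natrX powR_mulrn // ltW.
  have N0 : 0 < N by rewrite NE powR_gt0.
  have A0 : 0 < #|A|%:R :> R by rewrite AE mulr_gt0 ?powR_gt0.
  set alpha := _ / N.
  have alpha0 : 0 < alpha by rewrite divr_gt0.
  have alphaE : alpha = D * powR q%:R (- n%:R / s).
    rewrite /alpha AE NE -mulrA -powRB; last by rewrite (gt_eqF q0) implybT.
    by congr (_ * powR _ _); field; rewrite gt_eqF.
  have alpha_s : powR alpha s = powR D s / N.
    rewrite alphaE powRM ?powR_ge0 ?ltW // -powRrM divfK ?gt_eqF //.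
    by rewrite powRN NE.
  (* As [alpha^s = D^s / N], the error term [q^t * #|A|^t] is exactly the fraction [q^t / D^s] of
     the main term. *)
  have alpha_split : powR alpha (sigma R q ^+ t) = alpha ^+ t * (powR D s / N).
    rewrite -alpha_s -(powR_mulrn t (ltW alpha0)) -powRD ?(gt_eqF alpha0) ?implybT //.
    by congr powR; rewrite /s; ring.
  have A0' : (0 < #|A|)%N by rewrite -(ltr0n R).
  have := num_aff_in_supersaturation R hq t A0'; rewrite -/N -/alpha => super.
  rewrite ltr_pdivrMr ?ltr0n ?Aut_aff_gt0 // -mulrA mulrBl mul1r ltrBlDr.
  apply: lt_le_trans super _; rewrite lerD2l le_eqVlt; apply/orP; left; apply/eqP.
  have -> : #|A|%:R = alpha * N by rewrite divfK // gt_eqF.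
  have Ds0 : powR D s != 0 by rewrite gt_eqF // powR_gt0.
  rewrite alpha_split exprMn [N ^+ t.+1]exprS.
  by field; rewrite Ds0 gt_eqF.
split=> // n.
set b := powR _ _; have b0 : 0 < b by rewrite powR_gt0.
(* The bound holds for the default value 0 and is stable under maxima, so a single free [A]
   remains. *)
rewrite /ex_aff; elim/big_ind: _ => [//|x y xb yb|A /forallP free].
  by rewrite /maxn; case: ifP.
rewrite ltNge; apply/negP => b_le.
pose w : R := powR q%:R ((1 - 1 / s) * n%:R).
have w0 : 0 < w by rewrite powR_gt0.
(* If [#|A| >= b], then [D >= q^(t / s)] and [D^s >= q^t]; the lower bound of [count] is then
   nonnegative and forces a subspace in [A]. *)
pose D := #|A|%:R / w.
have bE : b = powR q%:R (t%:R / s) * w.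
  rewrite /b /w. rewrite -powRD ?(gt_eqF q0) ?implybT //.
  by congr powR; field; rewrite gt_eqF.
have D_ge : powR q%:R (t%:R / s) <= D by rewrite /D ler_pdivlMr // -bE.
have D0 : 0 < D by apply: lt_le_trans D_ge; rewrite powR_gt0.
have := count n A D D0; rewrite divfK ?gt_eqF // => /(_ erefl).
have -> : num_aff_in t A = 0%N.
  apply: eq_card0 => S; rewrite inE; apply/negP => /andP[aS SA].
  by have /implyP/(_ aS) := free S; rewrite SA.
rewrite ltNge => /negP; apply.
rewrite divr_ge0 // !mulr_ge0 ?powR_ge0 ?exprn_ge0 // subr_ge0.
rewrite ler_pdivrMr ?powR_gt0 // mul1r.
have -> : (q ^ t)%N%:R = powR (powR q%:R (t%:R / s)) s.
  by rewrite -powRrM divfK ?gt_eqF // powR_mulrn ?natrX // ltW.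
by apply: ge0_ler_powR; rewrite ?nnegrE ?powR_ge0 //; exact: ltW.
Qed.
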